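(* Let $\Gamma$ be a countable group and $(X,\mu)$ a standard probability space. (1) The type, $\mathrm{type}(\bm{a})$, of a measure preserving action $\bm{a}$ of $\Gamma$ is an invariant of weak equivalence; that is, if $\bm{a}$ and $\bm{b}$ are weakly equivalent measure preserving actions of $\Gamma$, then $\mathrm{type}(\bm{a})=\mathrm{type}(\bm{b})$. (2) The map $[\bm{a}]\mapsto\mathrm{type}(\bm{a})$ is a continuous map from the space $(A_\sim(\Gamma,X,\mu),\tau)$ of weak equivalence classes of measure preserving actions of $\Gamma$ on $(X,\mu)$ to the space $\mathrm{IRS}(\Gamma)$ of invariant random subgroups of $\Gamma$ equipped with the weak$^*$ topology.
   Context: A measure preserving action $\bm{a}=\Gamma\curvearrowright^a(X,\mu)$ is a Borel action of $\Gamma$ on a standard Borel space $X$ preserving a Borel probability measure $\mu$; $A(\Gamma,X,\mu)$ is the set of such actions on $(X,\mu)$ modulo almost everywhere equality. Weak containment: for $\bm{a}$ on $(X,\mu)$ and $\bm{b}$ on $(Y,\nu)$, $\bm{a}\prec\bm{b}$ means that for every finite Borel partition $A_0,\dots,A_{k-1}$ of $X$, every finite $F\subseteq\Gamma$, and every $\epsilon>0$ there is a Borel partition $B_0,\dots,B_{k-1}$ of $Y$ with $|\mu(\gamma^aA_i\cap A_j)-\nu(\gamma^bB_i\cap B_j)|<\epsilon$ for all $\gamma\in F$ and $i,j<k$. $\bm{a}$ and $\bm{b}$ are weakly equivalent, $\bm{a}\sim\bm{b}$, if $\bm{a}\prec\bm{b}$ and $\bm{b}\prec\bm{a}$; $[\bm{a}]$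 is the $\sim$-class of $\bm{a}$ in $A(\Gamma,X,\mu)$, and $A_\sim(\Gamma,X,\mu)$ is the set of all these classes. Topology $\tau$: let $K=2^{\mathbb N}$ be Cantor space, let $\Gamma$ act on $K^\Gamma$ by $(\gamma^sf)(\delta)=f(\gamma^{-1}\delta)$, and let $M_s(K^\Gamma)$ be the compact metrizable space of shift-invariant Borel probability measures on $K^\Gamma$ with the weak$^*$ topology. For Borel $\phi:X\to K$ let $\Phi^{\phi,a}(x)(\gamma)=\phi((\gamma^{-1})^ax)$, and let $E(\bm{a},K)=\{(\Phi^{\phi,a})_*\mu:\phi:X\to K\text{ Borel}\}\subseteq M_s(K^\Gamma)$. One has $\bm{a}\sim\bm{b}$ iff $\overline{E(\bm{a},K)}=\overline{E(\bm{b},K)}$. The topology $\tau$ is obtained by identifying $A_\sim(\Gamma,X,\mu)$, via $[\bm{a}]\mapsto\overline{E(\bm{a},K)}$, with a subset of the space of nonempty compact subsets of $M_s(K^\Gamma)$ with the Vietoris topology (this subset is closed). $\mathrm{Sub}(\Gamma)\subseteq2^\Gamma$ is the compact space of subgroups of $\Gamma$; an invariant random subgroup of $\Gamma$ is a Borel probability measure on $\mathrm{Sub}(\Gamma)$ invariant under conjugation by $\Gamma$, and $\mathrm{IRS}(\Gamma)$ is the set of all of these. For a measure preserving action $\bm{a}=\Gamma\curvearrowright^a(X,\mu)$, $\mathrm{type}(\bm{a})=(\mathrm{stab}_a)_*\mu\in\mathrm{IRS}(\Gamma)$, where $\mathrm{stab}_a(x)=\{\gamma\in\Gamma:\gamma^ax=x\}$.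 Part (1) is due to Abért and Elek. *)

(* Defs.v *)
From HB Require Import structures.
From mathcomp Require Import all_boot all_order all_algebra.
From mathcomp Require Import finmap.
From mathcomp Require Import all_classical all_reals all_analysis.
From mathcomp Require Import measurable_realfun.

Set Implicit Arguments.
Unset Strict Implicit.
Unset Printing Implicit Defensive.

Import Order.TTheory GRing.Theory Num.Theory.
Import numFieldNormedType.Exports.
Local Open Scope classical_set_scope.
Local Open Scope ring_scope.
Local Open Scope quotient_scope.

Notation borel T := (g_sigma_algebraType (@open T)).

(* X is Borel isomorphic to a Polish space; Polish spaces are presented by a
   complete metric, a separable one being second countable. *)
Definition standard_borel (R : realType) d (X : measurableType d) : Prop :=
  exists (T : completePseudoMetricType R) (h : X -> T),
    [/\ hausdorff_space T, @second_countable T, bijective h &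
        forall A : set X, measurable A <->
          exists2 B : set T, (@open T).-sigma.-measurable B & A = h @^-1` B].

Lemma measurable_into_borel d (X : measurableType d) (T : ptopologicalType)
    (f : X -> borel T) :
  (forall U : set T, open U -> measurable (f @^-1` U)) -> measurable_fun setT f.
Proof.
move=> mf; apply (@measurability _ _ X (borel T) setT f (@open T)) => //.
by move=> _ [U oU <-]; rewrite setTI; exact: mf.
Qed.

Lemma bigcup_measurable_countable d (X : measurableType d) I (B : set I)
    (F : I -> set X) :
  countable B -> (forall i, B i -> measurable (F i)) ->
  measurable (\bigcup_(i in B) F i).
Proof.
move=> /pfcard_geP[->|[e]] mF; first by rewrite bigcup_set0.
have -> : \bigcup_(i in B) F i = \bigcup_n F (e n).
  rewrite eqEsubset; split=> [x [i Bi Fix]|x [n _ Fx]].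
    by have [n _ en] := 'surj_e Bi; exists n => //; rewrite en.
  by exists (e n) => //; exact: funS.
by apply: bigcupT_measurable => n; apply: mF; exact: funS.
Qed.

Lemma basis_preimage_measurable d (X : measurableType d) (T : topologicalType)
    (B : set (set T)) (f : X -> T) :
  countable B -> basis B -> (forall V, B V -> measurable (f @^-1` V)) ->
  forall U : set T, open U -> measurable (f @^-1` U).
Proof.
move=> cB [_ bB] mf U oU.
have -> : f @^-1` U = \bigcup_(V in [set V | B V /\ V `<=` U]) f @^-1` V.
  rewrite eqEsubset; split=> [x Ufx|x [V [_ VU] Vfx]]; last exact: VU.
  have [V [BV Vfx] VU] := bB (f x) U (open_nbhs_nbhs (conj oU Ufx)).
  by exists V.
apply: bigcup_measurable_countable; last by move=> V [BV _]; exact: mf.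
by apply: sub_countable cB; apply: subset_card_le => V [].
Qed.

Section product_basis.
Context (I : eqType) (T : I -> topologicalType) (B : forall i, set (set (T i))).
Hypotheses (cI : countable [set: I]) (cB : forall i, countable (@B i)).
Hypothesis bB : forall i, basis (@B i).

Definition cylinders : set (set (prod_topology T)) :=
  \bigcup_(i in [set: I]) ((fun V => [set f | V (f i)]) @` @B i).

Definition product_basis := finI_from cylinders id.

Lemma countable_product_basis : countable product_basis.
Proof.
apply: finI_from_countable; apply: bigcup_countable => // i _.
by apply: card_le_trans (cB i); exact: card_image_le.
Qed.

Lemma basis_product_basis : basis product_basis.
Proof.
split.
  move=> _ [D DB <-]; rewrite openE => x Dx; apply: filter_bigI => W WD.
  have := DB W WD; rewrite inE => -[i _ [V BV WE]].
  apply: open_nbhs_nbhs; split; last exact: Dx.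
  rewrite -WE.
  have oV : open V by have [Bo _] := bB i; exact: Bo.
  exact: (proj1 (@continuousP (prod_topology T) (T i) (proj i)) (@proj_continuous I T i) V oV).
move=> x.
have FF : Filter (filter_from [set U | product_basis U /\ U x] id).
  apply: filter_from_filter.
    exists setT; split=> //; exists fset0 => //.
    by rewrite eqEsubset; split.
  move=> _ _ [[D DB <-] Dx] [[D' DB' <-] Dx'].
  exists (\bigcap_(i in [set` (D `|` D')%fset]) i).
    split; last by rewrite set_fsetU bigcap_setU.
    exists (D `|` D')%fset => // W.
    by rewrite !inE => /orP[/DB|/DB']; rewrite inE.
  by rewrite set_fsetU bigcap_setU.
apply/cvg_sup => i U /=.
case=> W [[V oV <-] Vx] VU.
have [V' [BV' V'x] V'V] := (bB i).2 (x i) V (open_nbhs_nbhs (conj oV Vx)).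
exists [set f | V' (f i)]; last by move=> f /V'V /VU.
split=> //; exists [fset [set f | V' (f i)]]%fset.
  by move=> _ /fset1P ->; rewrite inE; exists i => //; exists V'.
by rewrite set_fset1 bigcap_set1.
Qed.

End product_basis.

Lemma second_countable_prod (I : eqType) (T : I -> topologicalType) :
  countable [set: I] -> (forall i, @second_countable (T i)) ->
  @second_countable (prod_topology T).
Proof.
move=> cI /(_ _)/cid2-/all_sig2[B cB bB].
by exists (product_basis B); [exact: countable_product_basis|
  exact: basis_product_basis].
Qed.

Lemma second_countable_bool : @second_countable bool.
Proof.
exists (set1 @` [set: bool]).
  by apply: finite_set_countable; exact: finite_image.
split=> [U _|b U nU]; first exact: discrete_open.
by exists [set b]; [split=> //; exists b|move=> _ ->; exact: nbhs_singleton].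
Qed.

Lemma measurable_into_prod d (X : measurableType d) (I : eqType)
    (T : I -> topologicalType) (f : X -> prod_topology T) :
  countable [set: I] -> (forall i, @second_countable (T i)) ->
  (forall i (V : set (T i)), open V -> measurable [set x | V (f x i)]) ->
  forall U : set (prod_topology T), open U -> measurable (f @^-1` U).
Proof.
move=> cI /(_ _)/cid2-/all_sig2[B cB bB] mf.
apply: (basis_preimage_measurable (countable_product_basis cI cB)
  (basis_product_basis bB)).
move=> _ [D DB <-]; rewrite preimage_bigcap.
apply: fin_bigcap_measurable => // W WD.
have := DB W WD; rewrite inE => -[i _ [V BV <-]].
by apply: mf; have [Bo _] := bB i; exact: Bo.
Qed.

(* A library measure is a function on all sets, and only its values on the
   measurable ones are constrained; requiring the value 0 elsewhere makes
   Leibniz equality the equality of Borel measures. *)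
Definition borel_prob (R : realType) (T : ptopologicalType) : Type :=
  set_type [set P : probability (borel T) R |
            forall A : set T, ~ measurable (A : set (borel T)) -> P A = 0%E].

HB.instance Definition _ R T := Choice.on (borel_prob R T).

Definition borel_prob_val R T (P : borel_prob R T) : probability (borel T) R :=
  set_val P.
Coercion borel_prob_val : borel_prob >-> Probability.type.

(* The functional on C(T) given by a measure. All the spaces T below are
   compact, so that continuous functions on T are bounded. *)
Definition integral_functional (R : realType) (T : ptopologicalType)
    (P : borel_prob R T) : {ptws {f : T -> R | continuous f} -> R} :=
  fun f => \int[P]_x (sval f x).

HB.instance Definition _ (R : realType) (T : ptopologicalType) :=
  Topological.copy (borel_prob R T)
    (initial_topology (@integral_functional R T)).

Section pushforward.
Context (R : realType) d (X : measurableType d) (T : ptopologicalType).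
Context (P : probability X R) (f : X -> borel T) (mf : measurable_fun setT f).

Definition push_fun of measurable_fun setT f := fun A : set (borel T) =>
  if `[< measurable A >] then pushforward P f A else 0%E.

Local Notation pf := (push_fun mf).

Lemma push_funE (A : set (borel T)) :
  measurable A -> pf A = P (f @^-1` A).
Proof. by rewrite /push_fun => /asboolT ->. Qed.

Let pf0 : pf set0 = 0%E.
Proof. by rewrite push_funE// preimage_set0 measure0. Qed.

Let pf_ge0 A : (0 <= pf A)%E.
Proof. by rewrite /push_fun; case: ifP => // _; exact: measure_ge0. Qed.

Let pf_sigma_additive : semi_sigma_additive pf.
Proof.
move=> F mF tF mUF; rewrite push_funE// preimage_bigcup.
under eq_fun do under eq_bigr do rewrite push_funE//.
apply: measure_semi_sigma_additive.
- by move=> n; rewrite -[X in measurable X]setTI; exact: mf.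
- move/trivIsetP : tF => tF; apply/trivIsetP => i j _ _ ij.
  by rewrite -preimage_setI tF// preimage_set0.
- by rewrite -preimage_bigcup -[X in measurable X]setTI; exact: mf.
Qed.

HB.instance Definition _ := isMeasure.Build _ _ _ pf pf0 pf_ge0
  pf_sigma_additive.

Let pf_setT : pf setT = 1%E.
Proof. by rewrite push_funE// preimage_setT probability_setT. Qed.

HB.instance Definition _ := Measure_isProbability.Build _ _ _ pf pf_setT.

Lemma push_fun_off A : ~ measurable A -> pf A = 0%E.
Proof. by rewrite /push_fun => /asboolF ->. Qed.

Definition push : borel_prob R T :=
  exist _ (pf : probability _ _) (mem_set push_fun_off).

Lemma pushE (A : set (borel T)) : measurable A -> push A = P (f @^-1` A).
Proof. exact: push_funE. Qed.

End pushforward.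
Arguments push {R d X T} P {f} mf.

(* The topology is put on all the subsets of T at once; its subspace of nonempty
   compact subsets carries the usual Vietoris topology. It is only used on the
   sets closed_factor_measures a below, which are nonempty and compact since the
   space of invariant measures on the shift is compact. *)
Definition hyperspace (T : topologicalType) : Type := set T.

HB.instance Definition _ (T : topologicalType) := Choice.on (hyperspace T).

Definition vietoris_subbase (T : topologicalType) : set (set (hyperspace T)) :=
  [set W | exists2 U : set T, open U &
     W = [set A | A `<=` U] \/ W = [set A | A `&` U !=set0]].

HB.instance Definition _ (T : topologicalType) :=
  isSubBaseTopological.Build (hyperspace T) (@vietoris_subbase T) id.

Record mp_action (R : realType) (G : groupType) d (X : measurableType d)
    (mu : probability X R) := MpAction {
  act :> G -> X -> X;
  act1 : forall x, act 1%g x = x;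
  actM : forall g h x, act (g * h)%g x = act g (act h x);
  act_measurable : forall g, measurable_fun setT (act g);
  act_preserving : forall g A, measurable A -> mu (act g @^-1` A) = mu A }.
Arguments mp_action {R} G {d X} mu.

HB.instance Definition _ R G d X mu := gen_eqMixin (@mp_action R G d X mu).
HB.instance Definition _ R G d X mu := gen_choiceMixin (@mp_action R G d X mu).

Definition borel_partition d (X : measurableType d) k (A : 'I_k -> set X) :=
  [/\ forall i, measurable (A i), trivIset setT A & \bigcup_i A i = setT].

Definition weakly_contained (R : realType) (G : groupType)
    d (X : measurableType d) (mu : probability X R)
    d' (Y : measurableType d') (nu : probability Y R)
    (a : mp_action G mu) (b : mp_action G nu) : Prop :=
  forall k (A : 'I_k -> set X), borel_partition A ->
  forall F : set G, finite_set F ->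
  forall e : R, 0 < e ->
  exists2 B : 'I_k -> set Y, borel_partition B &
    forall g, F g -> forall i j,
      `| fine (mu (a g @` A i `&` A j)) - fine (nu (b g @` B i `&` B j)) | < e.

Definition weakly_equivalent (R : realType) (G : groupType)
    d (X : measurableType d) (mu : probability X R)
    d' (Y : measurableType d') (nu : probability Y R)
    (a : mp_action G mu) (b : mp_action G nu) : Prop :=
  weakly_contained a b /\ weakly_contained b a.

Section weak_equivalence_classes.
Context (R : realType) (G : groupType) d (X : measurableType d).
Context (mu : probability X R).

Lemma weakly_contained_refl (a : mp_action G mu) : weakly_contained a a.
Proof.
by move=> k A pA F fF e e0; exists A => // g Fg i j; rewrite subrr normr0.
Qed.

Lemma weakly_contained_trans (a b c : mp_action G mu) :
  weakly_contained a b -> weakly_contained b c -> weakly_contained a c.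
Proof.
move=> ab bc k A pA F fF e e0.
have e20 : 0 < e / 2 by rewrite divr_gt0.
have [B pB AB] := ab k A pA F fF _ e20.
have [C pC BC] := bc k B pB F fF _ e20.
exists C => // g Fg i j; rewrite (splitr e).
apply: le_lt_trans (ltrD (AB g Fg i j) (BC g Fg i j)).
exact: ler_distD.
Qed.

Definition ae_equal (a b : mp_action G mu) : bool :=
  `[< forall g, {ae mu, forall x, a g x = b g x} >].

Lemma ae_equal_refl : reflexive ae_equal.
Proof. by move=> a; apply/asboolP => g; exact: aeW. Qed.

Lemma ae_equal_sym : symmetric ae_equal.
Proof.
move=> a b; apply/asboolP/asboolP => ab g;
  by apply: filterS (ab g) => x ->.
Qed.

Lemma ae_equal_trans : transitive ae_equal.
Proof.
move=> b a c /asboolP ab /asboolP bc; apply/asboolP => g.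
by apply: filterS2 (ab g) (bc g) => x -> ->.
Qed.

Canonical ae_equal_equiv :=
  EquivRel ae_equal ae_equal_refl ae_equal_sym ae_equal_trans.

Definition actions := {eq_quot ae_equal}.
HB.instance Definition _ := Choice.on actions.
HB.instance Definition _ := EqQuotient.on actions.

Lemma act_image (a : mp_action G mu) g (A : set X) :
  a g @` A = a (g^-1)%g @^-1` A.
Proof.
rewrite eqEsubset; split=> [_ [x Ax <-]|x Ax] /=.
  by rewrite -actM mulVg act1.
by exists (a g^-1%g x) => //; rewrite -actM mulgV act1.
Qed.

Lemma measurable_act_preimage (a : mp_action G mu) g (A : set X) :
  measurable A -> measurable (a g @^-1` A).
Proof.
by move=> mA; rewrite -[X in measurable X]setTI; exact: act_measurable.
Qed.

Lemma ae_equal_measure (a b : mp_action G mu) g (A B : set X) : ae_equal a b ->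
  measurable A -> measurable B -> mu (a g @` A `&` B) = mu (b g @` A `&` B).
Proof.
move=> /asboolP/(_ g^-1%g)ab mA mB; rewrite !act_image.
have mI c : measurable ((c : mp_action G mu) g^-1%g @^-1` A `&` B).
  by apply: measurableI => //; exact: measurable_act_preimage.
rewrite -[in LHS](setIT (_ `&` B)) -[in RHS](setIT (_ `&` B)).
rewrite -!integral_indic//; apply: ae_eq_integral => //.
- by exact: (measurableT_comp _ (measurable_indic _)).
- by exact: (measurableT_comp _ (measurable_indic _)).
apply: filterS ab => x abx _; congr (_%:E); rewrite !indicE; congr (_%:R).
by congr nat_of_bool; apply/idP/idP; rewrite !inE /= abx.
Qed.

Lemma ae_equal_weakly_contained (a b : mp_action G mu) :
  ae_equal a b -> weakly_contained a b.
Proof.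
move=> ab k A pA F fF e e0; exists A => // g Fg i j.
have [mA _ _] := pA.
by rewrite (ae_equal_measure g ab (mA i) (mA j)) subrr normr0.
Qed.

Definition actions_equivalent (x y : actions) : bool :=
  `[< weakly_equivalent (repr x) (repr y) >].

Lemma actions_equivalent_pi (a b : mp_action G mu) :
  actions_equivalent (\pi a) (\pi b) <-> weakly_equivalent a b.
Proof.
have piK c : weakly_equivalent (repr (\pi_actions c)) c.
  have : ae_equal (repr (\pi_actions c)) c by apply/eqmodP; rewrite reprK.
  move=> cc; split; apply: ae_equal_weakly_contained => //.
  by rewrite ae_equal_sym.
have [[a1 a2] [b1 b2]] := (piK a, piK b).
split=> [/asboolP[ab ba]|[ab ba]]; last apply/asboolP; split.
- exact: weakly_contained_trans (weakly_contained_trans a2 ab) b1.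
- exact: weakly_contained_trans (weakly_contained_trans b2 ba) a1.
- exact: weakly_contained_trans (weakly_contained_trans a1 ab) b2.
- exact: weakly_contained_trans (weakly_contained_trans b1 ba) a2.
Qed.

Lemma actions_equivalent_refl : reflexive actions_equivalent.
Proof. by move=> x; apply/asboolP; split; exact: weakly_contained_refl. Qed.

Lemma actions_equivalent_sym : symmetric actions_equivalent.
Proof. by move=> x y; apply/asboolP/asboolP => -[]. Qed.

Lemma actions_equivalent_trans : transitive actions_equivalent.
Proof.
move=> y x z /asboolP[xy yx] /asboolP[yz zy]; apply/asboolP; split.
  exact: weakly_contained_trans xy yz.
exact: weakly_contained_trans zy yx.
Qed.

Canonical actions_equivalent_equiv := EquivRel actions_equivalent
  actions_equivalent_refl actions_equivalent_sym actions_equivalent_trans.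

Definition weak_classes := {eq_quot actions_equivalent}.
HB.instance Definition _ := Choice.on weak_classes.
HB.instance Definition _ := EqQuotient.on weak_classes.

Definition weak_class (a : mp_action G mu) : weak_classes :=
  \pi_weak_classes (\pi_actions a).

End weak_equivalence_classes.
Arguments actions {R} G {d X} mu.
Arguments weak_classes {R} G {d X} mu.

Definition shift_space (G : groupType) : Type :=
  prod_topology (fun _ : G => cantor_space).
HB.instance Definition _ G := Topological.on (shift_space G).
HB.instance Definition _ G :=
  isPointed.Build (shift_space G) (fun=> point).

Definition shift (G : groupType) (g : G) (f : shift_space G) : shift_space G :=
  fun h => f (g^-1 * h)%g.

Definition shift_invariant_measures (R : realType) (G : groupType) : Type :=
  set_type [set P : borel_prob R (shift_space G) |
    forall g (B : set (borel (shift_space G))), measurable B ->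
      P (shift g @^-1` B) = P B].
HB.instance Definition _ R G :=
  Topological.on (shift_invariant_measures R G).

Section topology_on_classes.
Context (R : realType) (G : groupType) (cG : countable [set: G]).
Context d (X : measurableType d) (mu : probability X R).

Definition factor_map (phi : X -> cantor_space) (a : mp_action G mu) (x : X) :
    shift_space G :=
  fun g => phi (a (g^-1)%g x).

Lemma second_countable_cantor : @second_countable cantor_space.
Proof.
apply: second_countable_prod => [|_]; first exact: countableP.
exact: second_countable_bool.
Qed.

Lemma shift_measurable g : measurable_fun setT
  (shift g : borel (shift_space G) -> borel (shift_space G)).
Proof.
apply: measurable_into_borel; apply: measurable_into_prod => // [_|h V oV].
  exact: second_countable_cantor.
apply: sub_sigma_algebra.
exact: (proj1 (@continuousP (shift_space G) cantor_space (proj (g^-1 * h)%g))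
  (@proj_continuous G (fun=> cantor_space) (g^-1 * h)%g) V oV).
Qed.

Lemma factor_map_measurable (phi : X -> cantor_space) (a : mp_action G mu) :
  measurable_fun setT (phi : X -> borel cantor_space) ->
  measurable_fun setT (factor_map phi a : X -> borel (shift_space G)).
Proof.
move=> mphi; apply: measurable_into_borel.
apply: measurable_into_prod => // [_|g V oV].
  exact: second_countable_cantor.
apply: (measurable_act_preimage a (g^-1)%g (A := phi @^-1` V)).
rewrite -[X in measurable X]setTI; apply: mphi => //.
exact: sub_sigma_algebra.
Qed.

Lemma factor_map_act (phi : X -> cantor_space) (a : mp_action G mu) g x :
  factor_map phi a (a g x) = shift g (factor_map phi a x).
Proof.
apply: (@funext G cantor_space) => h.
by rewrite /shift /factor_map -actM invgM invgK.
Qed.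

Lemma push_factor_map_invariant (phi : X -> cantor_space) (a : mp_action G mu)
    (mf : measurable_fun setT (factor_map phi a : X -> borel (shift_space G)))
    g (B : set (borel (shift_space G))) :
  measurable B -> push mu mf (shift g @^-1` B) = push mu mf B.
Proof.
move=> mB; have msB : measurable (shift g @^-1` B : set (borel (shift_space G))).
  by rewrite -[X in measurable X]setTI; exact: shift_measurable.
rewrite !pushE// -[RHS](act_preserving a g); last first.
  by rewrite -[X in measurable X]setTI; exact: mf.
by congr (mu _); rewrite eqEsubset; split=> x /=; rewrite factor_map_act.
Qed.

Definition factor_measure (phi : X -> cantor_space) (a : mp_action G mu)
    (mphi : measurable_fun setT (phi : X -> borel cantor_space)) :
    shift_invariant_measures R G :=
  exist _ (push mu (factor_map_measurable a mphi))
    (mem_set (push_factor_map_invariant (factor_map_measurable a mphi))).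

(* E(a, K), K being the Cantor space. *)
Definition factor_measures (a : mp_action G mu) :
    set (shift_invariant_measures R G) :=
  [set l | exists phi (mphi : measurable_fun setT (phi : X -> borel cantor_space)),
     l = factor_measure a mphi].

Definition closed_factor_measures (a : mp_action G mu) :
    hyperspace (shift_invariant_measures R G) :=
  closure (factor_measures a).

(* The choice of representatives is immaterial: two actions are weakly equivalent
   if and only if they have the same closed_factor_measures. *)
Definition class_factor_measures (c : weak_classes G mu) :
    hyperspace (shift_invariant_measures R G) :=
  closed_factor_measures (repr (repr c)).

Definition weak_class_space := initial_topology class_factor_measures.

End topology_on_classes.

Section invariant_random_subgroups.
Context (R : realType) (G : groupType).

Definition is_subgroup : set (prod_topology (fun _ : G => bool)) :=
  [set H | [/\ H 1%g, forall g h, H g -> H h -> H (g * h)%g &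
                forall g, H g -> H (g^-1)%g]].

Definition subgroups : Type := set_type is_subgroup.
HB.instance Definition _ := Topological.on subgroups.

Lemma trivial_is_subgroup : is_subgroup (fun g => g == 1%g).
Proof.
split=> //= [g h /eqP -> /eqP ->|g /eqP ->]; first by rewrite mulg1.
by rewrite invg1.
Qed.

HB.instance Definition _ := isPointed.Build subgroups
  (exist _ (fun g => g == 1%g) (mem_set trivial_is_subgroup)).

Lemma conj_is_subgroup (g : G) (H : subgroups) :
  is_subgroup (fun h => set_val H (g^-1 * h * g)%g).
Proof.
have [H1 HM HV] : is_subgroup (set_val H) by exact: set_valP.
split=> [|h k Hh Hk|h Hh] /=; first by rewrite mulg1 mulVg.
  have -> : (g^-1 * (h * k) * g = (g^-1 * h * g) * (g^-1 * k * g))%g.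
    by rewrite !mulgA mulgK.
  exact: HM.
have -> : (g^-1 * h^-1 * g = (g^-1 * h * g)^-1)%g.
  by rewrite !invgM invgK mulgA.
exact: HV.
Qed.

(* g H g^-1 *)
Definition conj_subgroup (g : G) (H : subgroups) : subgroups :=
  exist _ (fun h => set_val H (g^-1 * h * g)%g)
    (mem_set (conj_is_subgroup g H)).

Definition IRS : Type :=
  set_type [set P : borel_prob R subgroups |
    forall g (B : set (borel subgroups)), measurable B ->
      P (conj_subgroup g @^-1` B) = P B].
HB.instance Definition _ := Topological.on IRS.

End invariant_random_subgroups.

Section type_of_action.
Context (R : realType) (G : groupType) (cG : countable [set: G]).
Context d (X : measurableType d) (bX : standard_borel R X).
Context (mu : probability X R) (a : mp_action G mu).

Lemma stab_is_subgroup x : is_subgroup (fun g => `[< a g x = x >]).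
Proof.
split=> [|g h /asboolP gx /asboolP hx|g /asboolP gx]; apply/asboolP.
- exact: act1.
- by rewrite actM hx.
- by rewrite -[in LHS]gx -actM mulVg act1.
Qed.

Definition stab (x : X) : subgroups G :=
  exist _ (fun g => `[< a g x = x >]) (mem_set (stab_is_subgroup x)).

Lemma fixed_points_measurable g : measurable [set x | a g x = x].
Proof.
have [T [h [hT [B cB bB] bh mX]]] := bX.
have mh V : B V -> measurable (h @^-1` V).
  move=> BV; apply/mX; exists V => //; apply: sub_sigma_algebra.
  by have [Bo _] := bB; exact: Bo.
have -> : [set x | a g x = x] =
    ~` (\bigcup_(V in B) (a g @^-1` (h @^-1` V) `\` (h @^-1` V))).
  rewrite eqEsubset; split=> [x agx [V BV []] /=|x nx /=]; first by rewrite agx.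
  apply: (bij_inj bh); apply: hT; apply/not_notP => /= ncl.
  apply: nx.
  move: ncl => /existsNP[U /existsNP[W /not_implyP[nU /not_implyP[nW UW]]]].
  have [V [BV Vagx] VU] := bB.2 _ _ nU.
  exists V => //; split=> //= Vx; apply: UW; exists (h x); split.
    exact: VU.
  exact: nbhs_singleton.
apply: measurableC; apply: bigcup_measurable_countable => // V BV.
by apply: measurableD; [apply: measurable_act_preimage|]; exact: mh.
Qed.

Lemma stab_measurable : measurable_fun setT (stab : X -> borel (subgroups G)).
Proof.
apply: measurable_into_borel => _ [U oU <-].
have := @measurable_into_prod _ X G (fun=> bool)
  (fun x g => `[< a g x = x >]) cG (fun=> second_countable_bool).
apply => // g V _.
have mb b : measurable [set x | `[< a g x = x >] = b].
  have := fixed_points_measurable g; case: b => mfix.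
    rewrite (_ : [set x | _] = [set x | a g x = x])//.
    by rewrite eqEsubset; split=> x /= /asboolP.
  rewrite (_ : [set x | _] = ~` [set x | a g x = x]); first exact: measurableC.
  by rewrite eqEsubset; split=> x /=; case: asboolP.
have -> : [set x | V `[< a g x = x >]] =
    \bigcup_(b in V) [set x | `[< a g x = x >] = b].
  rewrite eqEsubset; split=> [x Vx|x [b Vb /= ab]]; first by exists `[< a g x = x >].
  by rewrite /= ab.
by apply: bigcup_measurable_countable => //; exact: countableP.
Qed.

Lemma conj_subgroup_measurable g : measurable_fun setT
  (conj_subgroup g : borel (subgroups G) -> borel (subgroups G)).
Proof.
apply: measurable_into_borel => _ [U oU <-].
have := @measurable_into_prod _ (borel (subgroups G)) G (fun=> bool)
  (fun H h => set_val H (g^-1 * h * g)%g) cG (fun=> second_countable_bool).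
apply => // h V oV; apply: sub_sigma_algebra.
exists (proj (g^-1 * h * g)%g @^-1` V) => //.
exact: (proj1 (@continuousP {ptws G -> bool} bool (proj (g^-1 * h * g)%g))
  (@proj_continuous G (fun=> bool) (g^-1 * h * g)%g) V oV).
Qed.

Lemma stab_act g x : stab (a g x) = conj_subgroup g (stab x).
Proof.
apply: val_inj; apply: (@funext G bool) => h.
change (`[< a h (a g x) = a g x >] = `[< a (g^-1 * h * g)%g x = x >]).
rewrite !actM; apply: asbool_equiv_eq; split=> [->|/(congr1 (a g))].
  by rewrite -actM mulVg act1.
by rewrite -[LHS]actM mulgV act1.
Qed.

Lemma push_stab_invariant g (B : set (borel (subgroups G))) : measurable B ->
  push mu stab_measurable (conj_subgroup g @^-1` B) =
  push mu stab_measurable B.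
Proof.
move=> mB.
have mcB : measurable (conj_subgroup g @^-1` B : set (borel (subgroups G))).
  by rewrite -[X in measurable X]setTI; exact: conj_subgroup_measurable.
rewrite !pushE// -[RHS](act_preserving a g); last first.
  by rewrite -[X in measurable X]setTI; exact: stab_measurable.
by congr (mu _); rewrite eqEsubset; split=> x /=; rewrite stab_act.
Qed.

Definition action_type : IRS R G :=
  exist _ (push mu stab_measurable) (mem_set push_stab_invariant).

End type_of_action.
Arguments action_type {R G} cG {d X} bX {mu} a.

(* Main.v *)
(* For a finite set [l] of elements of the group let [moved a l] be the set of
   points moved by some [g] in [l]; its complement is the preimage under [stab] of
   the set of subgroups containing [l], and these sets form a generating
   pi-system. For each [g], a maximal Borel set disjoint from its image under [g]
   and its two translates cover the points moved by [g]. Hence [moved a l] is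
   covered by [3 * size l] sets [M i] each disjoint from its image under some
   [g i] in [l].
   (1) Weak containment transfers a disjoint version of this cover to almost
   disjoint images in the other action, so the measure of [moved _ l] can only
   increase; by symmetry it is an invariant of weak equivalence.
   (2) As the number of sets in the cover depends on [l] alone, the measure of
   [moved a l] is the maximum over E(a, K) of the measure of one fixed clopen
   subset of the shift. Such a maximum is continuous for the Vietoris topology, and
   by inclusion-exclusion so is the type on every clopen set of subgroups defined
   by finitely many coordinates; these determine the weak* topology by
   compactness. *)
Require Import Defs.
From HB Require Import structures.
From mathcomp Require Import all_boot all_order all_algebra.
From mathcomp Require Import all_classical all_reals all_analysis.
From mathcomp Require Import measurable_realfun lra.

Set Implicit Arguments.
Unset Strict Implicit.
Unset Printing Implicit Defensive.

Import Order.TTheory GRing.Theory Num.Theory.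
Import numFieldNormedType.Exports.
Local Open Scope classical_set_scope.
Local Open Scope ring_scope.
Local Open Scope quotient_scope.

(** * Points moved by group elements and their covers by independent sets *)

Lemma standard_borel_separating (R : realType) d (X : measurableType d) :
  standard_borel R X ->
  exists W : nat -> set X, (forall n, measurable (W n)) /\
    forall x y, x <> y -> exists n, W n x /\ ~ W n y.
Proof.
move=> [T [h [hT [B cB bB] bh mX]]].
have B0 : B !=set0.
  have [V [BV _] _] := bB.2 point setT (@filterT _ (nbhs point) _).
  by exists V.
have /pfcard_geP[BE|[e]] := cB; first by case: B0; rewrite BE.
exists (fun n => h @^-1` e n); split=> [n|x y xy].
  apply/mX; exists (e n) => //; apply: sub_sigma_algebra.
  by have [Bo _] := bB; apply: Bo; exact: funS.
have : ~ cluster (nbhs (h x)) (h y) by move=> /hT/(bij_inj bh).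
move=> /existsNP[U /existsNP[V /not_implyP[nU /not_implyP[nV UV]]]].
have [W [BW Wx] WU] := bB.2 _ _ nU.
have [n _ en] := 'surj_e BW; exists n; rewrite en; split=> // Wy.
by apply: UV; exists (h y); split; [exact: WU|exact: nbhs_singleton].
Qed.

Section moved_points.
Context {R : realType} {G : groupType} {d} {X : measurableType d}.
Context (bX : standard_borel R X) {mu : probability X R} (a : mp_action G mu).

Definition moved (l : seq G) : set X := [set x | exists2 g, g \in l & a g x <> x].

Lemma measurable_moved l : measurable (moved l).
Proof.
have -> : moved l = \bigcup_(g in [set` l]) ~` [set x | a g x = x].
  by rewrite eqEsubset; split=> x [g]; exists g.
apply: fin_bigcup_measurable => // g _; apply: measurableC.
exact: fixed_points_measurable.
Qed.

Lemma moved_independent_cover g : exists M : nat -> set X,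
  [/\ forall i, measurable (M i), forall i x, M i x -> ~ M i (a g x) &
      forall x, a g x <> x -> exists2 i, (i < 3)%N & M i x].
Proof.
have [W [mW sepW]] := standard_borel_separating bX.
(* the union of the [M n] is a maximal set disjoint from its image under [g] *)
pose fix M n : set X := if n is m.+1 then
  M m `|` (W m `&` ~` (a g @^-1` W m) `&`
           ~` (a g @^-1` M m) `&` ~` (a g^-1%g @^-1` M m)) else set0.
have mM n : measurable (M n).
  elim: n => //= n IH; apply: measurableU => //.
  apply: measurableI; last first.
    by apply: measurableC; exact: measurable_act_preimage.
  apply: measurableI; last first.
    by apply: measurableC; exact: measurable_act_preimage.
  apply: measurableI => //.
  by apply: measurableC; exact: measurable_act_preimage.
have gK x : a g^-1%g (a g x) = x by rewrite -actM mulVg act1.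
have gVK x : a g (a g^-1%g x) = x by rewrite -actM mulgV act1.
have indM n x : M n x -> ~ M n (a g x).
  elim: n => // n IH /= [Mx|[[[Wx nWx] nMx] nMVx]] [Mgx|[[[Wgx ?] ?] nMgV]] //.
  - exact: IH Mx Mgx.
  - by apply: nMgV => /=; rewrite gK.
have leM n m : (n <= m)%N -> M n `<=` M m.
  elim: m => [|m IH]; first by rewrite leqn0 => /eqP ->.
  rewrite leq_eqVlt => /orP[/eqP ->//|]; rewrite ltnS => /IH nm x Mx.
  by left; exact: nm.
pose U : set X := \bigcup_n M n.
have mU : measurable U by exact: bigcupT_measurable.
have indU x : U x -> ~ U (a g x).
  move=> [n _ Mx] [m _ Mgx].
  apply: (indM (maxn n m) x); first by apply: leM Mx; exact: leq_maxl.
  by apply: leM Mgx; exact: leq_maxr.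
(* The three sets are [U], its preimage and its image under [a g], the image being written as a
   preimage under [a g^-1]. Indices above 2 repeat the last one. *)
exists (fun i => if i is 0%N then U else if i is 1%N then a g @^-1` U
  else a g^-1%g @^-1` U); split.
- by case=> [|[|i]] //; exact: measurable_act_preimage.
- case=> [|[|i]] x; [exact: indU|exact: indU|].
  by rewrite /= gK => UVx Ux; apply: (indU _ UVx); rewrite gVK.
(* [W n] contains [x] but not [a g x]. If neither [a g x] nor [a g^-1 x] is in [M n], then [x] meets
   every condition for entering at stage [n.+1]; otherwise a translate of [U] contains [x]. *)
- move=> x /nesym/sepW[n [Wx nWx]].
  have [Mx|nMx] := pselect (M n (a g x)); first by exists 1%N => //; exists n.
  have [Mx'|nMx'] := pselect (M n (a g^-1%g x)).
    by exists 2%N => //; exists n.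
  by exists 0%N => //; exists n.+1 => //=; right.
Qed.

(** The index [i] codes a pair: [i %/ 3] is a position in [l], and [i %% 3] selects one of the three
    sets for the element there. *)
Lemma moved_cover l : exists M : nat -> set X,
  [/\ forall i, measurable (M i),
      forall i x, M i x -> ~ M i (a (nth 1%g l (i %/ 3)) x) &
      forall x, moved l x -> exists2 i, (i < 3 * size l)%N & M i x].
Proof.
have /choice[M MP] := moved_independent_cover.
exists (fun i => M (nth 1%g l (i %/ 3)) (i %% 3)%N); split=> [i|i x|x [g gl gx]].
- by have [mM _ _] := MP (nth 1%g l (i %/ 3)).
- by have [_ iM _] := MP (nth 1%g l (i %/ 3)); exact: iM.
- have [_ _ /(_ x gx)[c c3 Mc]] := MP g.
  exists (index g l * 3 + c)%N.
    by rewrite [ltnRHS]mulnC -ltn_divLR// divnMDl// divn_small// addn0 index_mem.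
  by rewrite divnMDl// divn_small// addn0 modnMDl modn_small// nth_index.
Qed.

End moved_points.

(** * Weak containment and the measure of the moved points *)

Section type_invariance.
Context {R : realType} {G : groupType}.
Context {d} {X : measurableType d} (bX : standard_borel R X) {mu : probability X R}.
Context {d'} {Y : measurableType d'} (bY : standard_borel R Y) {nu : probability Y R}.

Lemma act_image1 {dZ} {Z : measurableType dZ} {la : probability Z R}
  (c : mp_action G la) (A : set Z) : c 1%g @` A = A.
Proof. by rewrite (_ : c 1%g = id) ?image_id//; apply/funext => x; exact: act1. Qed.

(** The disjoint pieces [D i] of the cover miss their images under [g i]. Weak containment gives
    sets [B i] of nearly the same measure that nearly miss theirs; removing the overlaps leaves
    disjoint sets of points moved by [b] and costs little measure. *)
Lemma weakly_contained_moved_le (a : mp_action G mu) (b : mp_action G nu) l :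
  weakly_contained a b -> (mu (moved a l) <= nu (moved b l))%E.
Proof.
move=> ab; have [M [mM iM cM]] := moved_cover bX a l.
set n := (3 * size l)%N in cM.
pose g i := nth 1%g l (i %/ 3).
have gl i : (i < n)%N -> g i \in l.
  by move=> ni; apply: mem_nth; rewrite ltn_divLR// mulnC.
pose D := seqDU M; have mD : forall i, measurable (D i) by exact: seqDU_measurable.
have iD i x : D i x -> ~ D i (a (g i) x).
  by move=> /(@subset_seqDU _ M) Mx /(@subset_seqDU _ M); exact: iM Mx.
(* The extra index [n] receives the complement of the pieces, which completes them to a
   partition. *)
pose A (i : 'I_n.+1) := if (i < n)%N then D i else ~` (\bigcup_(k < n) D k).
have pA : borel_partition A.
  split=> [i| |].
  - rewrite /A; case: ifP => // _; apply: measurableC.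
    by apply: bigcup_measurable.
  - apply/trivIsetP => i j _ _ ij; have nij : i <> j :> nat by move/val_inj/eqP; exact/negP.
    rewrite /A; case: ltnP => ni; case: ltnP => nj.
    + by have /trivIsetP := @trivIset_seqDU _ M; apply => //; exact/eqP.
    + by rewrite setIC -subset0 => x [] /= nx Dx; apply: nx; exists i.
    + by rewrite -subset0 => x [] /= nx Dx; apply: nx; exists j.
    + case: nij; apply/eqP.
      by rewrite eqn_leq (leq_trans (leq_ord i) nj) (leq_trans (leq_ord j) ni).
  - rewrite -subTset => x _; have [[k kn Dx]|nD] := pselect ((\bigcup_(k < n) D k) x).
      by exists (inord k) => //; rewrite /A inordK ?kn// ltnS ltnW.
    by exists ord_max => //; rewrite /A /= ltnn.
rewrite -[leLHS](fineK (fin_num_measure mu _ (measurable_moved bX a l))).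
rewrite -[leRHS](fineK (fin_num_measure nu _ (measurable_moved bY b l))) lee_fin.
apply/ler_addgt0Pr => e e0.
(* Each of the [n] pieces loses at most [2 * e']; [n.+1] in place of [n] keeps the denominator
   nonzero when [l] is empty. *)
pose e' := e / (2 * n.+1%:R).
have e'0 : 0 < e' by rewrite divr_gt0// mulr_gt0.
(* The identity is included so that the measures of [A i] and [B i] themselves are compared. *)
have fF1 : finite_set (1%g |` [set g i | i in `I_n.+1]).
  by rewrite finite_setU; split=> //; exact/finite_image/finite_II.
have [B [mB tB _] AB] := ab _ _ pA _ fF1 _ e'0.
pose w (i : 'I_n) : 'I_n.+1 := widen_ord (leqnSn n) i.
pose E (i : 'I_n) := B (w i) `\` (b (g i) @` B (w i)).
have mbB (i : 'I_n) : measurable (b (g i) @` B (w i)).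
  by rewrite act_image; exact: measurable_act_preimage.
have mE i : measurable (E i) by apply: measurableD.
have EB (i : 'I_n) : fine (mu (D i)) <= fine (nu (E i)) + 2 * e'.
  have Ai : A (w i) = D i by rewrite /A /= ltn_ord.
  have := AB 1%g (or_introl erefl) (w i) (w i).
  rewrite !act_image1 !setIid Ai => AB1.
  have : (1%g |` [set g i | i in `I_n.+1]) (g i).
    by right; exists i => //=; rewrite ltnS ltnW.
  move=> /AB/(_ (w i) (w i)); rewrite Ai.
  rewrite (_ : a (g i) @` D i `&` D i = set0); last first.
    by rewrite -subset0 => _ [[x Dx <-]]; exact: iD.
  rewrite measure0/= setIC => ABg.
  have : fine (nu (B (w i))) =
      fine (nu (E i)) + fine (nu (B (w i) `&` b (g i) @` B (w i))).
    rewrite -fineD ?fin_num_measure//; last exact: measurableI.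
    by congr fine; rewrite (measureDI _ (mB (w i)) (mbB i)).
  move: AB1 ABg; rewrite !ltr_norml => /andP[_ ?] /andP[? _] ?; lra.
have muD : fine (mu (moved a l)) <= \sum_(i < n) fine (mu (D i)).
  have -> : \sum_(i < n) fine (mu (D i)) = fine (\sum_(i < n) mu (D i))%E.
    by rewrite sum_fine// => i _; exact: fin_num_measure.
  have mM' : measurable (\big[setU/set0]_(i < n) M i) by exact: bigsetU_measurable.
  rewrite -(@measure_bigsetU _ _ _ mu _ mD (@trivIset_seqDU _ M) n) -bigsetU_seqDU.
  apply: fine_le; rewrite ?fin_num_measure//; first exact: measurable_moved.
  apply: le_measure; rewrite ?inE//; first exact: measurable_moved.
  by move=> x /cM[i ni Mx]; rewrite -bigcup_mkord; exists i.
have nuE : \sum_(i < n) fine (nu (E i)) <= fine (nu (moved b l)).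
  have -> : \sum_(i < n) fine (nu (E i)) = fine (\sum_(i < n) nu (E i))%E.
    by rewrite sum_fine// => i _; exact: fin_num_measure.
  have mE' : measurable (\big[setU/set0]_(i < n) E i) by exact: bigsetU_measurable.
  rewrite -(@measure_bigsetU_ord _ _ _ nu n xpredT E mE); last first.
    apply/trivIsetP => i j _ _ ij; move/trivIsetP : tB => /(_ (w i) (w j) I I) tB.
    rewrite -subset0 => x [[Bix _] [Bjx _]]; rewrite -tB//.
  apply: fine_le; rewrite ?fin_num_measure//; first exact: measurable_moved.
  apply: le_measure; rewrite ?inE//; first exact: measurable_moved.
  (* A point of [E i] fixed by [g i] would be its own image, hence in the removed overlap. *)
  move=> x; rewrite -bigcup_seq => -[i _ [Bx nBx]].
  by exists (g i); [exact: gl|move=> gx; apply: nBx; exists x].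
apply: le_trans muD _.
apply: (@le_trans _ _ (\sum_(i < n) (fine (nu (E i)) + 2 * e'))); first exact: ler_sum.
rewrite big_split/= sumr_const card_ord lerD// -[leLHS]mulr_natr.
have -> : e = 2 * e' * n.+1%:R.
  by rewrite /e' mulrAC [RHS]mulrC divfK// mulf_neq0// pnatr_eq0.
by rewrite ler_wpM2l ?ler_nat// mulr_ge0// ltW.
Qed.
End type_invariance.

(** * Measures on the space of subgroups *)

Lemma borel_prob_eq (R : realType) (T : ptopologicalType) (P Q : borel_prob R T) :
  (forall A : set (borel T), measurable A -> P A = Q A) -> P = Q.
Proof.
move=> PQ; apply: val_inj.
have {}PQ : (set_val P : set (borel T) -> \bar R) = set_val Q.
  apply/funext => A; have [|nA] := pselect (measurable A); first exact: PQ.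
  by rewrite (set_valP P A nA) (set_valP Q A nA).
move: PQ; rewrite /= /set_val /=.
case: P Q => [[P cP] /= _] [[Q cQ] /= _] PQ; move: PQ cP cQ => -> cP cQ.
congr Probability.Pack.
(* The underlying functions are now identical, and the remaining components are proofs. *)
move: cP cQ => [[p1 p2] [p3] [p4] [p5] [p6] [p7] [p8]]
  [[q1 q2] [q3] [q4] [q5] [q6] [q7] [q8]].
rewrite (Prop_irrelevance p1 q1)
  (Prop_irrelevance p2 q2)
  (Prop_irrelevance p3 q3)
  (Prop_irrelevance p4 q4)
  (Prop_irrelevance p5 q5)
  (Prop_irrelevance p6 q6)
  (Prop_irrelevance p7 q7)
  (Prop_irrelevance p8 q8)//.
Qed.

Section containing.
Context {G : groupType}.

Lemma clopen_coordinate (g : G) : clopen [set H : subgroups G | set_val H g].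
Proof.
have cH : continuous (fun H : subgroups G => set_val H g : bool).
  move=> H; apply: (@continuous_comp (subgroups G) (prod_topology (fun _ : G => bool)) bool
    set_val (fun f => f g)).
    exact: initial_continuous.
  exact: (@proj_continuous G (fun=> bool)).
apply: (preimage_clopen (A := [set b : bool | b]) _ cH); split.
  exact: discrete_open.
exact: discrete_closed.
Qed.

Definition containing (l : seq G) : set (subgroups G) :=
  [set H : subgroups G | forall g, g \in l -> set_val H g].

Lemma containing0 : containing [::] = setT.
Proof. by rewrite eqEsubset. Qed.

Lemma containing_cons g l :
  containing (g :: l) = [set H : subgroups G | set_val H g] `&` containing l.
Proof.
rewrite eqEsubset; split=> H; last first.
  by move=> [Hg Hl] h; rewrite inE => /orP[/eqP ->//|/Hl].
by move=> HC; split=> [|h hl] /=; apply: HC; rewrite inE ?eqxx// hl orbT.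
Qed.

Lemma containing_cat l1 l2 :
  containing (l1 ++ l2) = containing l1 `&` containing l2.
Proof.
elim: l1 => [|g l1 IH] /=; first by rewrite containing0 setTI.
by rewrite !containing_cons IH setIA.
Qed.

Lemma clopen_containing l : clopen (containing l).
Proof.
elim: l => [|g l IH]; first by rewrite containing0; exact: clopenT.
by rewrite containing_cons; apply: clopenI => //; exact: clopen_coordinate.
Qed.

Lemma measurable_containing l :
  measurable (containing l : set (borel (subgroups G))).
Proof. by apply: sub_sigma_algebra; have [] := clopen_containing l. Qed.

(** Concatenation of lists makes the sets [containing l] a pi-system. Those with a single element
    generate the Borel sets because [G] is countable. *)
Lemma subgroup_measure_eq (R : realType) (cG : countable [set: G])
    (P Q : borel_prob R (subgroups G)) :
  (forall l, P (containing l) = Q (containing l)) -> P = Q.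
Proof.
move=> PQ; apply: borel_prob_eq => A mA.
apply: (@measure_unique _ R (borel (subgroups G)) (range containing)
  (fun=> setT) _ _ _ _ P Q) => //.
- rewrite eqEsubset; split; last first.
    apply: smallest_sub; first exact: sigma_algebra_measurable.
    by move=> _ [l _ <-]; exact: measurable_containing.
  (* The remaining inclusion of sigma-algebras is the measurability of the identity from [S], which
     can be tested on coordinates. *)
  pose S := g_sigma_algebraType (range containing).
  suff mid : measurable_fun setT (id : S -> borel (subgroups G)).
    by move=> B mB; have := mid measurableT B mB; rewrite setTI.
  apply: measurable_into_borel => _ [U oU <-].
  have := @measurable_into_prod _ S G (fun=> bool)
    (fun H g => set_val H g) cG (fun=> second_countable_bool).
  apply => // g V _.
  have mg : measurable ([set H : subgroups G | set_val H g] : set S).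
    have -> : [set H : subgroups G | set_val H g] = containing [:: g].
      by rewrite containing_cons containing0 setIT.
    by apply: sub_sigma_algebra; exists [:: g].
  have -> : [set H : S | V (set_val H g)] =
     ([set H : subgroups G | set_val H g] `&` [set H | V true]) `|`
     (~` [set H : subgroups G | set_val H g] `&` [set H | V false]).
    rewrite eqEsubset; split=> H /=; first by case: (set_val H g); [left|right].
    by case: (set_val H g); case=> -[].
  have mV b : measurable ([set H | V b] : set S).
    have [Vb|nVb] := pselect (V b).
      by rewrite (_ : [set H | _] = setT)//; apply/seteqP; split.
    by rewrite (_ : [set H | _] = set0)//; apply/seteqP; split.
  by apply: measurableU; apply: measurableI => //; exact: measurableC.
- by move=> _ _ [l1 _ <-] [l2 _ <-]; exists (l1 ++ l2) => //; exact: containing_cat.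
- by move=> _; exists [::] => //; exact: containing0.
- by rewrite bigcup_const//; exists 0%N.
- by move=> _ [l _ <-]; exact: PQ.
- by move=> _ /=; rewrite probability_setT ltry.
Qed.

End containing.

Section type_of_action.
Context {R : realType} {G : groupType} (cG : countable [set: G]).
Context {d} {X : measurableType d} (bX : standard_borel R X) {mu : probability X R}.

Lemma action_type_containing (a : mp_action G mu) l :
  (set_val (action_type cG bX a) : borel_prob R _) (containing l) =
  (1 - mu (moved a l))%E.
Proof.
rewrite -probability_setC; last exact: measurable_moved.
rewrite pushE; last exact: measurable_containing.
congr (mu _); rewrite eqEsubset; split=> x /=.
  by move=> Hx [g gl]; apply; apply/asboolP; exact: Hx.
by move=> nx g gl; apply/asboolP; apply: contrapT => gx; apply: nx; exists g.
Qed.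

End type_of_action.

Lemma weakly_equivalent_type (R : realType) (G : groupType) (cG : countable [set: G])
  d (X : measurableType d) (bX : standard_borel R X) (mu : probability X R)
  d' (Y : measurableType d') (bY : standard_borel R Y) (nu : probability Y R)
  (a : mp_action G mu) (b : mp_action G nu) :
  weakly_equivalent a b -> action_type cG bX a = action_type cG bY b.
Proof.
move=> [ab ba]; apply: val_inj; apply: (subgroup_measure_eq cG) => l.
rewrite !action_type_containing; congr (1 - _)%E.
by apply/eqP; rewrite eq_le !weakly_contained_moved_le.
Qed.

(** * Continuity for the Vietoris and weak-star topologies *)

Lemma vietoris_subbase_open (T : topologicalType) (W : set (hyperspace T)) :
  vietoris_subbase W -> open W.
Proof.
move=> sW; exists [set W]; last exact: bigcup_set1.
by move=> _ ->; exact: (@finI_from1 _ _ _ id).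
Qed.

(* Hitting an open set is an open condition on a set [A], and so is being
   contained in one, so the supremum over [A] of a continuous function is a
   continuous function of [A]. *)
Lemma vietoris_max_continuous (R : realType) (W : choiceType)
    (S : topologicalType) (h : S -> R) (E : W -> set S) (v : W -> R) :
  continuous h -> (forall w s, E w s -> h s <= v w) ->
  (forall w, exists2 s, E w s & h s = v w) ->
  continuous (v : initial_topology (fun w => closure (E w) : hyperspace S) -> R).
Proof.
move=> ch hv vh w0.
have oh U : open U -> open (h @^-1` U) by apply: (proj1 (continuousP h)).
pose cE := fun w => closure (E w) : hyperspace S.
have FF := @nbhs_filter (initial_topology cE) w0.
apply/(@cvgrPdist_lt _ _ _ _ FF) => e e0.
pose U1 := h @^-1` [set y | v w0 - e < y].
pose U2 := h @^-1` [set y | y < v w0 + e].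
have o1 : open U1 by apply: oh; exact: open_gt.
have o2 : open U2 by apply: oh; exact: open_lt.
have oH : open ([set A | A `&` U1 !=set0] : set (hyperspace S)).
  by apply: vietoris_subbase_open; exists U1 => //; right.
have oS : open ([set A | A `<=` U2] : set (hyperspace S)).
  by apply: vietoris_subbase_open; exists U2 => //; left.
have H1 : (closure (E w0) `&` U1) !=set0.
  have [s Es hs] := vh w0; exists s; split; first exact: subset_closure.
  by rewrite /U1 /= hs ltrBlDr ltrDl.
have H2 : closure (E w0) `<=` U2.
  move=> s cs; rewrite /U2 /=; apply: (@le_lt_trans _ _ (v w0)); last by rewrite ltrDl.
  have cl : closed (h @^-1` [set y | y <= v w0]).
    by apply: (proj1 (continuous_closedP h)) => //; exact: closed_le.
  apply: cl; move: cs; apply: closure_subset => t; exact: hv.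
have nH := @initial_continuous _ _ cE w0 _ (open_nbhs_nbhs (conj oH H1)).
have nS := @initial_continuous _ _ cE w0 _ (open_nbhs_nbhs (conj oS H2)).
near=> w; rewrite ltr_distlC; apply/andP; split.
  (* An open set that meets the closure of [E w] meets [E w] itself, where [v w] is an upper
     bound. *)
  have [s [cs U1s]] : (cE w `&` U1) !=set0 by near: w.
  have [t [Et U1t]] := cs U1 (open_nbhs_nbhs (conj o1 U1s)).
  by apply: lt_le_trans U1t _; exact: hv.
have [s Es <-] := vh w.
have : cE w `<=` U2 by near: w.
by apply; exact: subset_closure.
Unshelve. all: by end_near. Qed.

Lemma clopen_indic_continuous (R : realType) (T : topologicalType) (C : set T) :
  clopen C -> continuous (\1_C : T -> R).
Proof.
move=> [oC cC] x.
have [Cx|nCx] := pselect (C x).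
  apply: (@near_cst_continuous T R (1 : R)).
  by near=> y; rewrite indicE mem_set//; near: y; exact: open_nbhs_nbhs.
apply: (@near_cst_continuous T R (0 : R)).
near=> y; rewrite indicE memNset//; near: y.
by apply: open_nbhs_nbhs; split=> //; exact: closed_openC.
Unshelve. all: by end_near. Qed.

Lemma ptws_eval_continuous (I : Type) (T : topologicalType) (i : I) :
  continuous (fun f : {ptws I -> T} => f i).
Proof.
move=> f; have /cvg_sup/(_ i) cf : f --> f by exact: cvg_id.
move=> A nA; apply: cf.
exact: (@initial_continuous _ _ (fun g : I -> T => g i) f A nA).
Qed.

Lemma continuous_into_ptws (Z : topologicalType) (I : Type) (T : topologicalType)
    (F : Z -> {ptws I -> T}) :
  (forall i, continuous (fun z => F z i)) -> continuous F.
Proof.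
move=> cF z; apply/cvg_sup => i U [_ [[V oV <-] Vz] VU].
apply: filterS VU _; apply: cF; exact: open_nbhs_nbhs.
Qed.

(** The indicator of a clopen set is a test function for the weak-star topology, and its integral is
    the measure of the set. *)
Lemma clopen_measure_continuous (R : realType) (T : ptopologicalType) (C : set T) :
  clopen C -> continuous (fun P : borel_prob R T => fine (P C)).
Proof.
move=> cC; pose f := exist (fun f : T -> R => continuous f) _
  (@clopen_indic_continuous R T C cC).
have mC : measurable (C : set (borel T)).
  by apply: sub_sigma_algebra; have [] := cC.
have -> : (fun P : borel_prob R T => fine (P C)) =
    (fun F => F f) \o (@integral_functional R T).
  apply/funext => P /=; rewrite /integral_functional /Rintegral /=.
  by rewrite integral_indic// setIT.
move=> P; apply: (@continuous_comp (borel_prob R T)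
  {ptws {f : T -> R | continuous f} -> R} R (@integral_functional R T)
  (fun F => F f)); first exact: initial_continuous.
exact: ptws_eval_continuous.
Qed.

(** * The measure of the moved points as a maximum over factors *)

Section moved_measure.
Context {R : realType} {G : groupType} (cG : countable [set: G]).
Context {d} {X : measurableType d} (bX : standard_borel R X) {mu : probability X R}.

(* Coordinate [i] of a point of the Cantor space stands for the indicator of the
   [i]-th set of [moved_cover]. *)
Definition moving_cylinder (l : seq G) : set (shift_space G) :=
  [set f | exists2 i, (i < 3 * size l)%N &
     f 1%g i && ~~ f (nth 1%g l (i %/ 3))^-1%g i].

Lemma clopen_moving_cylinder l : clopen (moving_cylinder l).
Proof.
have cc g i : clopen [set f : shift_space G | f g i].
  have cH : continuous (fun f : shift_space G => f g i : bool).
    move=> f; apply: (@continuous_comp (shift_space G) cantor_space bool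
      (fun f => f g) (fun k => k i)).
      exact: (@proj_continuous G (fun=> cantor_space)).
    exact: (@proj_continuous nat (fun=> bool)).
  apply: (preimage_clopen (A := [set b : bool | b]) _ cH); split.
    exact: discrete_open.
  exact: discrete_closed.
have -> : moving_cylinder l = \big[setU/set0]_(i < 3 * size l)
   ([set f : shift_space G | f 1%g i] `&`
    ~` [set f : shift_space G | f (nth 1%g l (i %/ 3))^-1%g i]).
  rewrite -(bigcup_mkord (3 * size l) (fun i => [set f : shift_space G | f 1%g i] `&`
    ~` [set f : shift_space G | f (nth 1%g l (i %/ 3))^-1%g i])).
  rewrite eqEsubset; split=> f [i i3].
    by move=> /andP[f1 /negP f2]; exists i.
  by move=> [f1 /negP f2]; exists i => //; apply/andP.
elim/big_ind: _ => [|A B|i _]; [exact: clopen0|exact: clopenU|].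
by apply: clopenI; [exact: cc|apply: (clopenC setT); exact: cc].
Qed.

Lemma measurable_moving_cylinder l :
  measurable (moving_cylinder l : set (borel (shift_space G))).
Proof. by apply: sub_sigma_algebra; have [] := clopen_moving_cylinder l. Qed.

(** The coordinates of [factor_map phi a x] at [1] and [g^-1] are [phi x] and [phi (a g x)]. In the
    cylinder they differ for some [g] in [l], so this [g] moves [x], whatever [phi] is. *)
Lemma factor_measure_moving_le (a : mp_action G mu) l s :
  factor_measures cG a s ->
  fine ((set_val s : borel_prob R _) (moving_cylinder l)) <= fine (mu (moved a l)).
Proof.
move=> [phi [mphi ->]].
have mC := measurable_moving_cylinder l.
have mpC : measurable (factor_map phi a @^-1` moving_cylinder l).
  rewrite -[X in measurable X]setTI.
  exact: (factor_map_measurable cG a mphi).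
rewrite pushE// fine_le ?fin_num_measure//; first exact: measurable_moved.
apply: le_measure; rewrite ?inE//; first exact: measurable_moved.
move=> x [i i3] /=; rewrite /factor_map invgK invg1 act1 => /andP[fx /negP fgx].
exists (nth 1%g l (i %/ 3)); first by rewrite mem_nth// ltn_divLR// mulnC.
by move=> gx; apply: fgx; rewrite gx.
Qed.

(** The bound is attained when [phi] codes membership in the sets of [moved_cover]: a moved point
    lies in some [M i] with [i < 3 * size l], and its image under the corresponding element does
    not. *)
Lemma factor_measure_moving_eq (a : mp_action G mu) l :
  exists2 s, factor_measures cG a s &
  fine ((set_val s : borel_prob R _) (moving_cylinder l)) = fine (mu (moved a l)).
Proof.
have [M [mM iM cM]] := moved_cover bX a l.
pose phi (x : X) : cantor_space := fun i => `[< M i x >].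
have mphi : measurable_fun setT (phi : X -> borel cantor_space).
  apply: measurable_into_borel; apply: measurable_into_prod.
  - exact: countableP.
  - by move=> _; exact: second_countable_bool.
  move=> i V _.
  have -> : [set x | V (phi x i)] =
     (M i `&` [set x | V true]) `|` (~` M i `&` [set x | V false]).
    rewrite /phi eqEsubset; split=> x /=; first by case: asboolP; [left|right].
    by case: asboolP => Mx [[]|[]].
  have mV b : measurable [set x : X | V b].
    have [Vb|nVb] := pselect (V b).
      by rewrite (_ : [set _ | _] = setT)//; apply/seteqP; split.
    by rewrite (_ : [set _ | _] = set0)//; apply/seteqP; split.
  by apply: measurableU; apply: measurableI => //; exact: measurableC.
have fm : factor_measures cG a (factor_measure cG a mphi) by exists phi, mphi.
exists (factor_measure cG a mphi) => //.
apply/eqP; rewrite eq_le factor_measure_moving_le//=.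
have mC := measurable_moving_cylinder l.
have mpC : measurable (factor_map phi a @^-1` moving_cylinder l).
  rewrite -[X in measurable X]setTI.
  exact: (factor_map_measurable cG a mphi).
rewrite pushE// fine_le ?fin_num_measure//; first exact: measurable_moved.
apply: le_measure; rewrite ?inE//; first exact: measurable_moved.
move=> x /cM[i i3 Mx]; exists i => //=.
rewrite /factor_map invgK invg1 act1 /phi asboolT//=.
by apply/asboolPn; exact: iM.
Qed.

Lemma moved_measure_continuous l : continuous
  (fun c : weak_class_space cG mu => fine (mu (moved (repr (repr c)) l))).
Proof.
apply: (@vietoris_max_continuous R (weak_classes G mu)
  (shift_invariant_measures R G)
  (fun s => fine ((set_val s : borel_prob R _) (moving_cylinder l)))
  (fun c => factor_measures cG (repr (repr c)))).
- have c1 := @clopen_measure_continuous R _ _ (clopen_moving_cylinder l).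
  have c2 : continuous (set_val : shift_invariant_measures R G -> borel_prob R (shift_space G)).
    exact: initial_continuous.
  move=> s; exact: continuous_comp (c2 s) (c1 _).
- by move=> c s; exact: factor_measure_moving_le.
- by move=> c; exact: factor_measure_moving_eq.
Qed.

End moved_measure.

(** * Compactness and uniform continuity on the space of subgroups *)

Section compactness_of_subgroups.
Context {G : groupType}.
Local Notation power := (prod_topology (fun _ : G => bool)).

Lemma nbhs_agree (x : power) (l : seq G) :
  nbhs x [set y : power | forall g, g \in l -> y g = x g].
Proof.
elim: l => [|g l IH].
  by apply: filterS (@filterT _ (nbhs x) _).
have ng : nbhs x [set y : power | y g = x g].
  apply: (@proj_continuous G (fun=> bool) g x [set b | b = x g]).
  by rewrite nbhs_principalE.
apply: filterS2 ng IH => y yg yl h.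
by rewrite inE => /orP[/eqP ->|/yl].
Qed.

(** Convergence in a product is coordinatewise, and each coordinate occurs as some [u k], so it is
    fixed from stage [k.+1] on. *)
Lemma agree_cvg (u : nat -> G) (x : power) (V : set power) :
  set_surj setT setT u -> nbhs x V ->
  exists n, [set y : power | forall i, (i < n)%N -> y (u i) = x (u i)] `<=` V.
Proof.
move=> su.
pose A n := [set y : power | forall i, (i < n)%N -> y (u i) = x (u i)].
have FF : Filter (filter_from setT A).
  apply: filter_from_filter; first by exists 0%N.
  move=> m n _ _; exists (maxn m n) => // y Ay; split=> i im; apply: Ay.
    by rewrite leq_max im.
  by rewrite leq_max im orbT.
suff cx : filter_from setT A --> x by move=> /cx[n _ AV]; exists n.
apply/cvg_sup => g U [_ [[W oW <-] Wx] WU].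
have [k _ ukg] := su g I; exists k.+1 => // y Ay.
by apply: WU; rewrite /= -ukg (Ay k (ltnSn k)) ukg.
Qed.

(** Each subgroup axiom involves at most three coordinates, on which a point of the closure agrees
    with some subgroup. Hence the subgroups are closed in a compact product. *)
Lemma compact_is_subgroup : compact (@is_subgroup G).
Proof.
have cT : compact [set: power].
  have := @tychonoff G (fun=> bool) (fun=> setT) (fun=> bool_compact).
  by rewrite (_ : [set f | _] = setT)//; apply/seteqP; split.
apply: subclosed_compact cT _ => // x clx; split=> [|g h xg xh|g xg].
- have [y [[y1 _ _] yx]] := clx _ (nbhs_agree x [:: 1%g]).
  by rewrite -yx ?mem_head.
- have [y [[_ yM _] yx]] := clx _ (nbhs_agree x [:: g; h; (g * h)%g]).
  by rewrite -yx ?inE ?eqxx ?orbT//; apply: yM; rewrite yx ?inE ?eqxx ?orbT.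
- have [y [[_ _ yV] yx]] := clx _ (nbhs_agree x [:: g; g^-1%g]).
  by rewrite -yx ?inE ?eqxx ?orbT//; apply: yV; rewrite yx ?inE ?eqxx ?orbT.
Qed.

Lemma subgroups_unif_continuous (R : realType) (u : nat -> G)
    (f : subgroups G -> R) (e : R) :
  set_surj setT setT u -> continuous f -> 0 < e ->
  exists n, forall H H' : subgroups G,
    (forall i, (i < n)%N -> set_val H (u i) = set_val H' (u i) :> bool) ->
    `|f H - f H'| < e.
Proof.
move=> su cf e0.
have /compact_near_coveringP/near_covering_withinP nc := compact_is_subgroup.
(* Compactness, used as a near-covering property along [n] tending to infinity, makes a local number
   of coordinates uniform. It concerns points [x] of the full product, whence the quantification
   over [H] with value [x]. *)
have [|n _ /(_ n (leqnn n)) nP] := nc nat \oo (fun n (x : power) => forall H H' : subgroups G,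
    set_val H = x ->
    (forall i, (i < n)%N -> set_val H (u i) = set_val H' (u i) :> bool) ->
    `|f H - f H'| < e) _.
  move=> x Kx; pose H0 : subgroups G := exist _ x (mem_set Kx).
  have e20 : 0 < e / 2 by rewrite divr_gt0.
  have : nbhs H0 [set H | `|f H0 - f H| < e / 2].
    exact: (proj1 (cvgrPdist_lt _ _) (cf H0) _ e20).
  move=> [_ [[V oV <-] Vx] VH].
  have [m mV] := agree_cvg su (open_nbhs_nbhs (conj oV Vx)).
  exists ([set y : power | forall g, g \in map u (iota 0 m) -> y g = x g],
          [set k | (m <= k)%N]) => /=.
    by split; [exact: nbhs_agree|exists m].
  move=> [y k] /= [yx mk] Ky H H' Hy HH'.
  have ag i : (i < m)%N -> y (u i) = x (u i).
    by move=> im; apply: yx; apply: map_f; rewrite mem_iota.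
  have fH : `|f H0 - f H| < e / 2 by apply: VH; apply: mV => i /ag; rewrite Hy.
  have fH' : `|f H0 - f H'| < e / 2.
    apply: VH; apply: mV => i im; transitivity (y (u i)); last exact: ag.
    by rewrite -Hy; apply/esym/HH'; exact: leq_trans im mk.
  rewrite (splitr e); apply: le_lt_trans (ltrD fH fH').
  by rewrite (distrC (f H0) (f H)); exact: ler_distD.
exists n => H H' HH'; apply: (nP (set_val H)) => //; exact: set_valP.
Qed.

End compactness_of_subgroups.

(** * Approximation of integrals by step functions *)

Lemma continuous_real_measurable (R : realType) (T : ptopologicalType) (f : T -> R) :
  continuous f -> measurable_fun setT (f : borel T -> R).
Proof.
move=> /continuousP cf; apply: (measurability _ (RGenOpens.measurableE R)).
move=> _ [_ [a [b ->] <-]]; rewrite setTI; apply: sub_sigma_algebra.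
exact/cf/interval_open.
Qed.

Lemma Rintegral_step (R : realType) d (T : measurableType d) (P : probability T R)
    (I : Type) (s : seq I) (r : I -> R) (C : I -> set T) :
  (forall i, measurable (C i)) ->
  P.-integrable setT (EFin \o (fun x => \sum_(i <- s) r i * \1_(C i) x)) /\
  \int[P]_x (\sum_(i <- s) r i * \1_(C i) x) = \sum_(i <- s) r i * fine (P (C i)).
Proof.
move=> mC.
have iC i : P.-integrable setT (EFin \o (\1_(C i) : T -> R)) by exact: integrable_indic.
elim: s => [|i s [iS eS]].
  rewrite (_ : (fun x => _) = cst (0 : R)); last first.
    by apply/funext => x; rewrite big_nil.
  split; first exact: finite_measure_integrable_cst.
  by rewrite Rintegral_cst// mul0r big_nil.
have ir : P.-integrable setT (EFin \o (fun x => r i * \1_(C i) x)).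
  by have := integrableZl measurableT (r i) (iC i).
rewrite (_ : (fun x => _) =
    (fun x => r i * \1_(C i) x + \sum_(j <- s) r j * \1_(C j) x)); last first.
  by apply/funext => x; rewrite big_cons.
split; first by have := integrableD measurableT ir iS.
rewrite RintegralD// eS RintegralZl// big_cons; congr (_ * _ + _).
by rewrite /Rintegral integral_indic// setIT.
Qed.

(** The difference [f - s] is measurable and bounded by [e], hence integrable for a probability
    measure; so [f] is integrable as its sum with [s]. *)
Lemma Rintegral_close (R : realType) d (T : measurableType d) (P : probability T R)
    (f s : T -> R) (e : R) :
  measurable_fun setT f -> P.-integrable setT (EFin \o s) ->
  (forall x, `|f x - s x| <= e) -> `|\int[P]_x f x - \int[P]_x s x| <= e.
Proof.
move=> mf iS fs.
have ms : measurable_fun setT s.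
  by apply/measurable_EFinP; case/integrableP : iS.
have ie : P.-integrable setT (EFin \o cst e) by exact: finite_measure_integrable_cst.
have id : P.-integrable setT (EFin \o (fun x => f x - s x)).
  apply: le_integrable ie => //.
    by apply/measurable_EFinP; exact: measurable_funB.
  move=> x _; rewrite /= lee_fin (le_trans (fs x))//; exact: ler_norm.
have if_ : P.-integrable setT (EFin \o f).
  rewrite (_ : EFin \o f = (EFin \o (fun x => f x - s x)) \+ (EFin \o s)).
    exact: integrableD.
  by apply/funext => x /=; rewrite -EFinD subrK.
rewrite -RintegralB//; apply: le_trans (le_normr_Rintegral _ id) _ => //.
have -> : e = \int[P]_x (cst e x).
  rewrite Rintegral_cst// -[LHS]mulr1; congr (_ * _).
  exact/esym/(congr1 fine (probability_setT P)).
by apply: le_Rintegral => //; exact: integrable_norm.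
Qed.

(** * Weak-star continuity from the measures of finite conditions *)

Section continuity_of_subgroup_measures.
Context {R : realType} {G : groupType} (cG : countable [set: G]).

Definition avoiding (l : seq G) : set (subgroups G) :=
  [set H : subgroups G | forall g, g \in l -> ~ set_val H g].

Lemma clopen_avoiding l : clopen (avoiding l).
Proof.
elim: l => [|g l IH].
  by rewrite (_ : avoiding _ = setT); [exact: clopenT|rewrite eqEsubset].
rewrite (_ : avoiding _ = (~` [set H : subgroups G | set_val H g]) `&` avoiding l).
  by apply: clopenI => //; apply: (clopenC setT); exact: clopen_coordinate.
rewrite eqEsubset; split=> H; last first.
  by move=> [Hg Hl] h; rewrite inE => /orP[/eqP ->//|/Hl].
by move=> HC; split=> [|h hl] /=; apply: HC; rewrite inE ?eqxx// hl orbT.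
Qed.

Context (Z : topologicalType) (P : Z -> borel_prob R (subgroups G)).
Hypothesis cP : forall l, continuous (fun z => fine (P z (containing l))).

(** Avoiding [g] as well subtracts the measure of the part containing [g]. This moves [g] to the
    first list, so the induction on [l2] is for all [l1]. *)
Lemma containing_avoiding_continuous l1 l2 :
  continuous (fun z => fine (P z (containing l1 `&` avoiding l2))).
Proof.
elim: l2 l1 => [|g l2 IH] l1.
  rewrite (_ : avoiding _ = setT); last by rewrite eqEsubset.
  by rewrite setIT.
have mD l k : measurable (containing l `&` avoiding k : set (borel (subgroups G))).
  apply: measurableI; first exact: measurable_containing.
  by apply: sub_sigma_algebra; have [] := clopen_avoiding k.
have -> : (fun z => fine (P z (containing l1 `&` avoiding (g :: l2)))) =
  (fun z => fine (P z (containing l1 `&` avoiding l2)) -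
            fine (P z (containing (g :: l1) `&` avoiding l2))).
  apply/funext => z; rewrite -fineB ?fin_num_measure//; congr fine.
  have BA : containing (g :: l1) `&` avoiding l2 `<=` containing l1 `&` avoiding l2.
    by rewrite containing_cons => H [[]].
  rewrite -{1}(setIidr BA) -measureD// ?ltey_eq ?fin_num_measure//; congr (P z _).
  rewrite eqEsubset; split=> H.
    move=> [H1 Hg]; split; last first.
      move=> [] ; rewrite containing_cons => -[Hg' _] _.
      by apply: Hg Hg'; rewrite mem_head.
    by split=> // h hl; apply: Hg; rewrite inE hl orbT.
  move=> [[H1 H2] nH]; split=> // h; rewrite inE => /orP[/eqP -> Hg|/H2//].
  by apply: nH; split=> //; rewrite containing_cons.
by move=> z; apply: cvgB; exact: IH.
Qed.

(** A test function is uniformly close to a step function on finitely many cylinders, so its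
    integrals are close for all measures at once. The integral of the step function is a finite
    combination of continuous cylinder measures. *)
Lemma continuous_subgroup_measures : continuous P.
Proof.
apply: continuous_comp_initial; apply: continuous_into_ptws => -[f cf] z.
rewrite /integral_functional /=.
have {}cf : continuous f := cf.
have [u su] : exists u : nat -> G, set_surj setT setT u.
  have /pfcard_geP[G0|[u]] := cG; last by exists u.
  by have : [set: G] 1%g by []; rewrite G0.
apply/cvgrPdist_lt => e e0.
(* Three errors of at most [e / 4] add up: the approximations of the integrals at [z] and at [y],
   and the variation of the step sums between them. *)
have e40 : 0 < e / 4 by rewrite divr_gt0.
have [n nf] := subgroups_unif_continuous su cf e40.
pose trace (H : subgroups G) : {ffun 'I_n -> bool} := [ffun i : 'I_n => set_val H (u i)].
pose C t := trace @^-1` [set t].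
(* For a pattern [t] realized by no subgroup the value is the default [point]; it is harmless since
   [C t] is then empty. *)
pose rep t := xget point (C t).
pose s H := \sum_(t : {ffun 'I_n -> bool}) f (rep t) * \1_(C t) H.
have CE t : C t = containing [seq u i | i : 'I_n <- enum 'I_n & t i] `&`
                  avoiding [seq u i | i : 'I_n <- enum 'I_n & ~~ t i].
  rewrite eqEsubset; split=> H.
    move=> <-; split=> _ /mapP[i + ->]; rewrite mem_filter ffunE => /andP[]//.
    by move=> /negP.
  move=> [H1 H2]; apply/ffunP => i; rewrite ffunE.
  case: (boolP (t i)) => ti.
    by apply: H1; apply: map_f; rewrite mem_filter ti mem_enum.
  by apply/negP/H2; apply: map_f; rewrite mem_filter ti mem_enum.
have mC t : measurable (C t : set (borel (subgroups G))).
  rewrite CE; apply: measurableI; first exact: measurable_containing.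
  by apply: sub_sigma_algebra; have [] := clopen_avoiding [seq u i | i : 'I_n <- enum 'I_n & ~~ t i].
have fs H : `|f H - s H| <= e / 4.
  rewrite /s (bigD1 (trace H))//= big1 ?addr0; last first.
    by move=> t tH; rewrite indicE memNset ?mulr0// => /esym/eqP; exact/negP.
  rewrite indicE mem_set// mulr1; apply/ltW/nf => i ni.
  have : C (trace H) (rep (trace H)) by apply: xgetI; exact: (erefl (trace H)).
  by move=> /ffunP/(_ (Ordinal ni)); rewrite !ffunE.
have iS y := (Rintegral_step (P y) (index_enum _) (f \o rep) mC).
have close y : `|\int[P y]_x f x - \sum_t f (rep t) * fine (P y (C t))| <= e / 4.
  rewrite -(iS y).2; apply: Rintegral_close => //; last exact: (iS y).1.
  exact: continuous_real_measurable.
have cs : continuous (fun y => \sum_t f (rep t) * fine (P y (C t))).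
  apply: continuous_big; first exact: add_continuous.
  move=> t _ y; apply: cvgM; first exact: cvg_cst.
  have cC : continuous (fun y => fine (P y (C t))).
    by rewrite CE; exact: containing_avoiding_continuous.
  exact: cC.
have nz := proj1 (cvgrPdist_lt _ _) (cs z) _ e40; near=> y.
have : `|\sum_t f (rep t) * fine (P z (C t)) -
         \sum_t f (rep t) * fine (P y (C t))| < e / 4 by near: y; exact: nz.
have := close z; have := close y.
rewrite !ler_norml !ltr_norml => /andP[? ?] /andP[? ?] /andP[? ?].
by apply/andP; split; lra.
Unshelve. all: by end_near. Qed.

End continuity_of_subgroup_measures.

Theorem theorem5p2 (R : realType) (G : groupType) (cG : countable [set: G])
    (d : measure_display) (X : measurableType d) (bX : standard_borel R X)
    (mu : probability X R) :
  (forall (dY : measure_display) (Y : measurableType dY)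
      (bY : standard_borel R Y) (nu : probability Y R)
      (a : mp_action G mu) (b : mp_action G nu),
    weakly_equivalent a b -> action_type cG bX a = action_type cG bY b) /\
  (exists type_map : weak_class_space cG mu -> IRS R G,
    (forall a : mp_action G mu,
      type_map (weak_class a) = action_type cG bX a) /\
    continuous type_map).
Proof.
split=> [dY Y bY nu a b|]; first exact: weakly_equivalent_type.
(* [repr c] is a class modulo almost everywhere equality and the outer [repr] an action in it; part
   (1) makes the type independent of both choices. *)
exists (fun c => action_type cG bX (repr (repr c))); split=> [a|].
  apply: weakly_equivalent_type; apply/actions_equivalent_pi.
  have : repr (weak_class a) = \pi_(actions G mu) a %[mod weak_classes G mu].
    by rewrite reprK.
  by move=> /eqmodP; rewrite /= reprK.
apply: continuous_comp_initial.
apply: (@continuous_subgroup_measures R G cG (weak_class_space cG mu)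
  (fun c => set_val (action_type cG bX (repr (repr c))))) => l.
rewrite (_ : (fun c => _) = (fun c : weak_class_space cG mu =>
    1 - fine (mu (moved (repr (repr c)) l)))).
  move=> c; have FF := @nbhs_filter (weak_class_space cG mu) c.
  have cm := @moved_measure_continuous R G cG d X bX mu l c.
  have c1 := @cvg_cst _ (1 : R) _ _ FF.
  exact: (@cvgB _ _ _ _ FF _ _ _ _ c1 cm).
apply: (@funext (weak_class_space cG mu) R) => c; rewrite action_type_containing.
by rewrite fineB// fin_num_measure//; exact: measurable_moved.
Qed.
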